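(* Let $M^n=\overline M^p\times\widetilde M^{n-p}$ be a product manifold and let $\Pi,\Psi$ be $1$-forms on $M$. Then $M$ is a $HGK_n$ with $(\Pi,\Psi)$ if and only if the following conditions hold simultaneously (at every point of $U$): 1.(i) $\overline\nabla\,\overline R=\overline\Pi\otimes\overline R+\overline\Psi\otimes\overline g\wedge\overline S$, (ii) $\widetilde\Pi\otimes\overline R+\widetilde\Psi\otimes\overline g\wedge\overline S=0$; 2.(i) $\overline\Pi\otimes\widetilde R+\overline\Psi\otimes\widetilde g\wedge\widetilde S=0$, (ii) $\widetilde\nabla\widetilde R=\widetilde\Pi\otimes\widetilde R+\widetilde\Psi\otimes\widetilde g\wedge\widetilde S$; 3.(i) $\overline\Psi\otimes\overline g\otimes\widetilde S=-\overline\Psi\otimes\overline S\otimes\widetilde g$, (ii) $\widetilde\Psi\otimes\overline g\otimes\widetilde S=-\widetilde\Psi\otimes\overline S\otimes\widetilde g$.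
   Context: Curvature conventions. For a semi-Riemannian metric $g$ with Levi-Civita connection $\nabla$: $R_{ijkl}=g\big((\nabla_{\partial_j}\nabla_{\partial_i}-\nabla_{\partial_i}\nabla_{\partial_j})\partial_k,\partial_l\big)$ is the $(0,4)$ Riemann-Christoffel tensor and $S_{jk}=g^{il}R_{ijkl}$ the Ricci tensor. For symmetric $(0,2)$-tensors $A,E$, the Kulkarni-Nomizu product is $(A\wedge E)_{ijkl}=A_{il}E_{jk}+A_{jk}E_{il}-A_{ik}E_{jl}-A_{jl}E_{ik}$. In $\nabla R=\Pi\otimes R+\dots$ the $1$-form index is the differentiation index: $R_{ijkl,m}=\Pi_mR_{ijkl}+\dots$. Product. $(\overline M,\overline g)$ and $(\widetilde M,\widetilde g)$ are semi-Riemannian manifolds of dimensions $p$ and $n-p$ ($1\le p<n$, $n\ge3$) and $M=\overline M\times\widetilde M$ carries the product metric $g=\overline g+\widetilde g$; $M$ is assumed non-flat. Overlined (resp. tilded) tensors $\overline R,\overline S,\overline\nabla$ (resp. $\widetilde R,\widetilde S,\widetilde\nabla$) are those of $\overline g$ (resp. $\widetilde g$) pulled back to $M$; tensor products of base and fibre tensors are compared componentwise, irrespective of the order of factors. For a $1$-form $\Pi$ on $M$, $\overline\Pi$ and $\widetilde\Pi$ denote its parts with components along $\overline M$ and $\widetilde M$ respectively (components are functions on $M$), and similarly for $\Psi$. Definition. Let $U=\{x\in M:\nabla R\ne\xi\otimes R\text{ at }x\text{ for every }1\text{-form }\xi\}$. $M$ is a $HGK_n$ (hyper generalized recurrent) with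 $(\Pi,\Psi)$ if $\nabla R=\Pi\otimes R+\Psi\otimes g\wedge S$ holds on $U$. *)

(* Defs.v *)
From HB Require Import structures.
From mathcomp Require Import all_boot all_order all_algebra.
From mathcomp Require Import all_classical all_reals all_analysis.

Set Implicit Arguments.
Unset Strict Implicit.
Unset Printing Implicit Defensive.

Import Order.TTheory GRing.Theory Num.Theory.
Import numFieldNormedType.Exports.
Local Open Scope classical_set_scope.
Local Open Scope ring_scope.

Section Smooth.
Context {R : realType}.

Definition pd n (i : 'I_n) (f : 'rV[R]_n -> R) : 'rV[R]_n -> R :=
  fun u => 'D_(delta_mx 0 i) f u.

Definition iter_pd n (s : seq 'I_n) (f : 'rV[R]_n -> R) : 'rV[R]_n -> R :=
  foldr (@pd n) f s.

(* C^infinity on D; only used for open D. *)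
Definition smooth_on n (D : set 'rV[R]_n) (f : 'rV[R]_n -> R) : Prop :=
  forall (s : seq 'I_n) (u : 'rV[R]_n), D u ->
    {for u, continuous (iter_pd s f)} /\
    forall i : 'I_n, derivable (iter_pd s f) u (delta_mx 0 i).

(* Transposed Jacobian: row i holds the partial derivatives in direction i. *)
Definition jacT n m (f : 'rV[R]_n -> 'rV[R]_m) (u : 'rV[R]_n) : 'M[R]_(n, m) :=
  \matrix_(i, k) pd i (fun v => f v 0 k) u.

End Smooth.

(* [cmap] is meaningful on [cdom] only, and [cinv] on its image only. *)
Record chart (R : realType) (n : nat) (M : topologicalType) := Chart {
  cdom : set M;
  cmap : M -> 'rV[R]_n;
  cinv : 'rV[R]_n -> M;
  cdom_open : open cdom;
  cimg_open : open (cmap @` cdom);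
  cmapK : forall x, cdom x -> cinv (cmap x) = x;
  cmap_cont : forall x, cdom x -> {for x, continuous cmap};
  cinv_cont : forall u, (cmap @` cdom) u -> {for u, continuous cinv}
}.

(* Smooth manifold, given by a (not necessarily maximal) smooth atlas. *)
Record manifold (R : realType) (n : nat) := Manifold {
  points :> topologicalType;
  m_hausdorff : hausdorff_space points;
  m_second_countable : @second_countable points;
  charts : Type;
  chart_of : charts -> chart R n points;
  m_cover : forall x : points, exists c, cdom (chart_of c) x;
  m_smooth : forall (c d : charts) (k : 'I_n),
    smooth_on
      (cmap (chart_of c) @` (cdom (chart_of c) `&` cdom (chart_of d)))
      (fun u => cmap (chart_of d) (cinv (chart_of c) u) 0 k)
}.

Section Charts.
Context {R : realType} {n : nat} (M : manifold R n).

Definition dom (c : charts M) : set M := cdom (chart_of c).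
Definition crd (c : charts M) : M -> 'rV[R]_n := cmap (chart_of c).
Definition img (c : charts M) : set 'rV[R]_n := crd c @` dom c.
Definition transition (c d : charts M) : 'rV[R]_n -> 'rV[R]_n :=
  fun u => crd d (cinv (chart_of c) u).

End Charts.

(* A (smooth) 1-form: its components in each chart, as functions of the
   coordinates, with the covariant transformation law. *)
Record one_form (R : realType) (n : nat) (M : manifold R n) := OneForm {
  ocomp :> charts M -> 'rV[R]_n -> 'rV[R]_n;
  o_smooth : forall c (i : 'I_n), smooth_on (img c) (fun u => ocomp c u 0 i);
  o_transf : forall (c d : charts M) (x : M), dom c x -> dom d x ->
    ocomp c (crd c x) = ocomp d (crd d x) *m (jacT (transition c d) (crd c x))^T
}.

(* Sylvester normal form with k entries -1. *)
Definition has_index (R : realType) n (k : nat) (A : 'M[R]_n) : Prop :=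
  exists P : 'M[R]_n, exists d : 'rV[R]_n,
    [/\ P \in unitmx, P *m A *m P^T = diag_mx d,
        forall i, d 0 i = 1 \/ d 0 i = -1 &
        #|[pred i | d 0 i == -1]| = k].

Record semi_riemannian (R : realType) (n : nat) := SemiRiemannian {
  sr_manifold :> manifold R n;
  metric : charts sr_manifold -> 'rV[R]_n -> 'M[R]_n;
  g_smooth : forall c (i j : 'I_n),
    smooth_on (img c) (fun u => metric c u i j);
  g_sym : forall c u, img c u -> (metric c u)^T = metric c u;
  g_nondeg : forall c u, img c u -> metric c u \in unitmx;
  g_index : exists k, forall c u, img c u -> has_index k (metric c u);
  g_transf : forall (c d : charts sr_manifold) (x : sr_manifold),
    dom c x -> dom d x ->
    let J := jacT (transition c d) (crd c x) in
    metric c (crd c x) = J *m metric d (crd d x) *m J^T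
}.

(* Covariant tensors at a point, by components in a chart. *)
Definition tens1 (R : realType) n := 'I_n -> R.
Definition tens2 (R : realType) n := 'I_n -> 'I_n -> R.
Definition tens4 (R : realType) n := 'I_n -> 'I_n -> 'I_n -> 'I_n -> R.
Definition tens5 (R : realType) n :=
  'I_n -> 'I_n -> 'I_n -> 'I_n -> 'I_n -> R.

Definition kulkarni_nomizu (R : realType) n (A E : tens2 R n) : tens4 R n :=
  fun i j k l => A i l * E j k + A j k * E i l - A i k * E j l - A j l * E i k.

Section Curvature.
Context {R : realType} {n : nat} (M : semi_riemannian R n) (c : charts M).

(* christoffel a i j u is Gamma^a_{ij} at the point of coordinates u. *)
Definition christoffel (a i j : 'I_n) (u : 'rV[R]_n) : R :=
  2^-1 * \sum_(b < n) invmx (metric c u) a b *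
    (pd i (fun v => metric c v j b) u + pd j (fun v => metric c v i b) u
     - pd b (fun v => metric c v i j) u).

Definition coord_field (k : 'I_n) : 'rV[R]_n -> 'rV[R]_n :=
  fun _ => delta_mx 0 k.

(* Levi-Civita derivative of the vector field V along the i-th coordinate
   field. *)
Definition nabla (i : 'I_n) (V : 'rV[R]_n -> 'rV[R]_n) :
    'rV[R]_n -> 'rV[R]_n :=
  fun u => \row_a (pd i (fun v => V v 0 a) u
                   + \sum_(b < n) christoffel a i b u * V u 0 b).

Definition gtens (u : 'rV[R]_n) : tens2 R n := fun i j => metric c u i j.

Definition riemann (u : 'rV[R]_n) : tens4 R n := fun i j k l =>
  ((nabla j (nabla i (coord_field k)) u - nabla i (nabla j (coord_field k)) u)
   *m metric c u *m (delta_mx 0 l : 'rV[R]_n)^T) 0 0.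

Definition ricci (u : 'rV[R]_n) : tens2 R n := fun j k =>
  \sum_(i < n) \sum_(l < n) invmx (metric c u) i l * riemann u i j k l.

(* nabla_riemann u i j k l m is R_{ijkl,m}. *)
Definition nabla_riemann (u : 'rV[R]_n) : tens5 R n := fun i j k l m =>
  pd m (fun v => riemann v i j k l) u
  - \sum_(a < n) christoffel a m i u * riemann u a j k l
  - \sum_(a < n) christoffel a m j u * riemann u i a k l
  - \sum_(a < n) christoffel a m k u * riemann u i j a l
  - \sum_(a < n) christoffel a m l u * riemann u i j k a.

End Curvature.

Section HGK.
Context {R : realType} {n : nat} (M : semi_riemannian R n).

Definition flat : Prop := forall (x : M) (c : charts M), dom c x ->
  forall i j k l, riemann c (crd c x) i j k l = 0.

Definition recurrent_at (xi : one_form M) (x : M) : Prop :=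
  forall c : charts M, dom c x -> let u := crd c x in
  forall i j k l m,
    nabla_riemann c u i j k l m = xi c u 0 m * riemann c u i j k l.

Definition nonrecurrent_set : set M :=
  [set x | forall xi : one_form M, ~ recurrent_at xi x].

Definition HGK (Pi Psi : one_form M) : Prop :=
  forall x : M, nonrecurrent_set x ->
  forall c : charts M, dom c x -> let u := crd c x in
  forall i j k l m,
    nabla_riemann c u i j k l m =
      Pi c u 0 m * riemann c u i j k l
      + Psi c u 0 m * kulkarni_nomizu (gtens c u) (ricci c u) i j k l.

End HGK.

(* Product manifolds, with the atlas of product charts: the first p
   coordinates are base coordinates, the last q are fibre coordinates. *)
Section ProductChart.
Context {R : realType} {p q : nat} {X Y : topologicalType}.
Variables (c : chart R p X) (d : chart R q Y).

Definition pc_dom : set (X * Y) := [set z | cdom c z.1 /\ cdom d z.2].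
Definition pc_map (z : X * Y) : 'rV[R]_(p + q) :=
  row_mx (cmap c z.1) (cmap d z.2).
Definition pc_inv (u : 'rV[R]_(p + q)) : X * Y :=
  (cinv c (lsubmx u), cinv d (rsubmx u)).

Lemma pc_imgE : pc_map @` pc_dom =
  [set u | (cmap c @` cdom c) (lsubmx u) /\ (cmap d @` cdom d) (rsubmx u)].
Proof.
apply/seteqP; split => [u [z [z1 z2] <-]|u [[x xc xE] [y yd yE]]] /=.
  by rewrite /pc_map row_mxKl row_mxKr; split; [exists z.1|exists z.2].
by exists (x, y) => //=; rewrite /pc_map /= xE yE hsubmxK.
Qed.

Lemma pc_dom_open : open pc_dom.
Proof.
rewrite (_ : pc_dom = fst @^-1` cdom c `&` snd @^-1` cdom d) //.
apply: openI; (apply: open_comp; last exact: cdom_open).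
  by move=> [x y] _; exact: cvg_fst.
by move=> [x y] _; exact: cvg_snd.
Qed.

Lemma pc_img_open : open (pc_map @` pc_dom).
Proof.
rewrite pc_imgE; apply: (@openI _ (@lsubmx R 1 p q @^-1` (cmap c @` cdom c))
                               (@rsubmx R 1 p q @^-1` (cmap d @` cdom d))).
  apply: open_comp => [z _|]; last exact: cimg_open.
  exact: continuous_lsubmx.
apply: open_comp => [z _|]; last exact: cimg_open.
exact: continuous_rsubmx.
Qed.

Lemma pc_mapK z : pc_dom z -> pc_inv (pc_map z) = z.
Proof.
by case: z => x y [/= xc yd]; rewrite /pc_inv row_mxKl row_mxKr !cmapK.
Qed.

Lemma pc_map_cont z : pc_dom z -> {for z, continuous pc_map}.
Proof.
case: z => x y [/= xc yd]; apply/cvg_ballP => e e0.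
have /cvg_ballP/(_ e e0) Hx := cmap_cont xc.
have /cvg_ballP/(_ e e0) Hy := cmap_cont yd.
exists ([set x' | ball (cmap c x) e (cmap c x')],
        [set y' | ball (cmap d y) e (cmap d y')]) => //.
move=> [x' y'] [/= [_ bx] [_ bY]]; split => // i j.
by rewrite /pc_map !mxE; case: fintype.split => k; [exact: bx|exact: bY].
Qed.

Lemma pc_inv_cont u : (pc_map @` pc_dom) u -> {for u, continuous pc_inv}.
Proof.
rewrite pc_imgE => -[uc ud].
have hc : {for u, continuous (cinv c \o @lsubmx R 1 p q)}.
  by apply: continuous_comp; [exact: continuous_lsubmx|exact: cinv_cont].
have hd : {for u, continuous (cinv d \o @rsubmx R 1 p q)}.
  by apply: continuous_comp; [exact: continuous_rsubmx|exact: cinv_cont].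
exact: (cvg_pair hc hd).
Qed.

Definition prod_chart : chart R (p + q) (X * Y)%type :=
  Chart pc_dom_open pc_img_open pc_mapK pc_map_cont pc_inv_cont.

End ProductChart.

Section SplitCalculus.
Context {R : realType} {p q : nat}.
Implicit Types (h : 'rV[R]_p -> R) (k : 'rV[R]_q -> R).

Let ldelta (i : 'I_p) : lsubmx (delta_mx 0 (lshift q i) : 'rV[R]_(p + q)) =
  delta_mx 0 i.
Proof. by apply/rowP => j; rewrite !mxE eq_lshift. Qed.

Let ldelta0 (i : 'I_q) :
  lsubmx (delta_mx 0 (rshift p i) : 'rV[R]_(p + q)) = 0.
Proof. by apply/rowP => j; rewrite !mxE eq_lrshift. Qed.

Let rdelta (i : 'I_q) : rsubmx (delta_mx 0 (rshift p i) : 'rV[R]_(p + q)) =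
  delta_mx 0 i.
Proof. by apply/rowP => j; rewrite !mxE eq_rshift. Qed.

Let rdelta0 (i : 'I_p) :
  rsubmx (delta_mx 0 (lshift q i) : 'rV[R]_(p + q)) = 0.
Proof. by apply/rowP => j; rewrite !mxE eq_rlshift. Qed.

Let lZD (t : R) (e u : 'rV[R]_(p + q)) :
  lsubmx (t *: e + u) = t *: lsubmx e + lsubmx u.
Proof. by apply/rowP => j; rewrite !mxE. Qed.

Let lquot h (e u : 'rV[R]_(p + q)) :
  (fun t : R => t^-1 *: (((h \o lsubmx) \o shift u) (t *: e) - (h \o lsubmx) u))
  = (fun t : R => t^-1 *:
      ((h \o shift (lsubmx u)) (t *: lsubmx e) - h (lsubmx u))).
Proof. by apply/funext => t /=; rewrite lZD. Qed.

Let rZD (t : R) (e u : 'rV[R]_(p + q)) :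
  rsubmx (t *: e + u) = t *: rsubmx e + rsubmx u.
Proof. by apply/rowP => j; rewrite !mxE. Qed.

Let rquot k (e u : 'rV[R]_(p + q)) :
  (fun t : R => t^-1 *: (((k \o rsubmx) \o shift u) (t *: e) - (k \o rsubmx) u))
  = (fun t : R => t^-1 *:
      ((k \o shift (rsubmx u)) (t *: rsubmx e) - k (rsubmx u))).
Proof. by apply/funext => t /=; rewrite rZD. Qed.

Lemma pd_lsub (i : 'I_p) h : pd (lshift q i) (h \o lsubmx) = pd i h \o lsubmx.
Proof. by apply/funext => u; rewrite /pd /derive lquot ldelta. Qed.

Lemma pd_lsub0 (i : 'I_q) h : pd (rshift p i) (h \o lsubmx) = (cst 0 : _ -> R).
Proof.
apply/funext => u; rewrite /pd /derive lquot ldelta0.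
rewrite (_ : (fun _ => _) = cst 0); last first.
  by apply/funext => t /=; rewrite scaler0 add0r subrr scaler0.
exact: lim_cst.
Qed.

Lemma pd_rsub (i : 'I_q) k : pd (rshift p i) (k \o rsubmx) = pd i k \o rsubmx.
Proof. by apply/funext => u; rewrite /pd /derive rquot rdelta. Qed.

Lemma pd_rsub0 (i : 'I_p) k : pd (lshift q i) (k \o rsubmx) = (cst 0 : _ -> R).
Proof.
apply/funext => u; rewrite /pd /derive rquot rdelta0.
rewrite (_ : (fun _ => _) = cst 0); last first.
  by apply/funext => t /=; rewrite scaler0 add0r subrr scaler0.
exact: lim_cst.
Qed.

Lemma derivable_lsub h u (i : 'I_(p + q)) :
  (forall a, derivable h (lsubmx u) (delta_mx 0 a)) ->
  derivable (h \o lsubmx : 'rV[R]_(p + q) -> R) u (delta_mx 0 i).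
Proof.
move=> dh; rewrite /derivable lquot.
have [a ->|b ->] := split_ordP i; first by rewrite ldelta; exact: dh.
rewrite ldelta0.
rewrite (_ : (fun _ => _) = cst 0); first exact: is_cvg_cst.
by apply/funext => t /=; rewrite scaler0 add0r subrr scaler0.
Qed.

Lemma derivable_rsub k u (i : 'I_(p + q)) :
  (forall a, derivable k (rsubmx u) (delta_mx 0 a)) ->
  derivable (k \o rsubmx : 'rV[R]_(p + q) -> R) u (delta_mx 0 i).
Proof.
move=> dh; rewrite /derivable rquot.
have [a ->|b ->] := split_ordP i; last by rewrite rdelta; exact: dh.
rewrite rdelta0.
rewrite (_ : (fun _ => _) = cst 0); first exact: is_cvg_cst.
by apply/funext => t /=; rewrite scaler0 add0r subrr scaler0.
Qed.

Lemma iter_pd_cst0 n (s : seq 'I_n) : iter_pd s (cst 0 : _ -> R) = cst 0.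
Proof.
elim: s => //= i s ->; apply/funext => u; rewrite /pd.
exact: derive_cst.
Qed.

Lemma smooth_cst0 n (D : set 'rV[R]_n) : smooth_on D (cst 0).
Proof.
move=> s u Du; rewrite iter_pd_cst0; split; first exact: cst_continuous.
by move=> i; exact: derivable_cst.
Qed.

Lemma iter_pd_lsub (s : seq 'I_(p + q)) h :
  (exists s', iter_pd s (h \o lsubmx) = iter_pd s' h \o lsubmx)
  \/ iter_pd s (h \o lsubmx) = (cst 0 : _ -> R).
Proof.
elim: s => [|i s [[s' /= ->]|/= ->]]; first by left; exists [::].
  have [a ->|b ->] := split_ordP i; last by right; exact: pd_lsub0.
  by left; exists (a :: s'); exact: pd_lsub.
by right; exact: (iter_pd_cst0 [:: i]).
Qed.

Lemma iter_pd_rsub (s : seq 'I_(p + q)) k :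
  (exists s', iter_pd s (k \o rsubmx) = iter_pd s' k \o rsubmx)
  \/ iter_pd s (k \o rsubmx) = (cst 0 : _ -> R).
Proof.
elim: s => [|i s [[s' /= ->]|/= ->]]; first by left; exists [::].
  have [a ->|b ->] := split_ordP i; first by right; exact: pd_rsub0.
  by left; exists (b :: s'); exact: pd_rsub.
by right; exact: (iter_pd_cst0 [:: i]).
Qed.

Lemma smooth_lsub D (D' : set 'rV[R]_(p + q)) h : smooth_on D h ->
  (forall u, D' u -> D (lsubmx u)) -> smooth_on D' (h \o lsubmx).
Proof.
move=> sh DD s u /DD Du.
have [[s' ->]|->] := iter_pd_lsub s h; last exact: (@smooth_cst0 _ setT [::]).
have [ch dh] := sh s' _ Du; split.
  by apply: (@continuous_comp _ _ _ (@lsubmx R 1 p q));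
    [exact: continuous_lsubmx|exact: ch].
by move=> i; exact: derivable_lsub.
Qed.

Lemma smooth_rsub D (D' : set 'rV[R]_(p + q)) k : smooth_on D k ->
  (forall u, D' u -> D (rsubmx u)) -> smooth_on D' (k \o rsubmx).
Proof.
move=> sh DD s u /DD Du.
have [[s' ->]|->] := iter_pd_rsub s k; last exact: (@smooth_cst0 _ setT [::]).
have [ch dh] := sh s' _ Du; split.
  by apply: (@continuous_comp _ _ _ (@rsubmx R 1 p q));
    [exact: continuous_rsubmx|exact: ch].
by move=> i; exact: derivable_rsub.
Qed.

End SplitCalculus.

Section ProductManifold.
Context {R : realType} {p q : nat}.

Lemma prod_hausdorff (X Y : topologicalType) :
  hausdorff_space X -> hausdorff_space Y -> hausdorff_space (X * Y)%type.
Proof.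
move=> hX hY [x y] [x' y'] cl; congr pair.
  apply: hX => A B nA nB.
  have [||z [/= Az Bz]] := cl (fst @^-1` A) (fst @^-1` B).
  - exact: (cvg_fst nA).
  - exact: (cvg_fst nB).
  - by exists z.1.
apply: hY => A B nA nB.
have [||z [/= Az Bz]] := cl (snd @^-1` A) (snd @^-1` B).
- exact: (cvg_snd nA).
- exact: (cvg_snd nB).
- by exists z.2.
Qed.

Lemma prod_second_countable (X Y : topologicalType) :
  @second_countable X -> @second_countable Y ->
  @second_countable (X * Y)%type.
Proof.
move=> [B cB [oB bB]] [C cC [oC bC]].
exists ((fun UV => UV.1 `*` UV.2) @` (B `*` C)).
  by apply: sub_countable (card_image_le _ _) _; exact: countableX.
split=> [_ [[U V] [/= BU CV] <-]|[x y] W].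
  rewrite (_ : U `*` V = fst @^-1` U `&` snd @^-1` V) //.
  apply: openI.
    by apply: open_comp; [move=> [x y] _; exact: cvg_fst|exact: oB].
  by apply: open_comp; [move=> [x y] _; exact: cvg_snd|exact: oC].
move=> [[U V] [/= /bB[U' [BU' U'x] UU'] /bC[V' [CV' V'y] VV']] UVW].
exists (U' `*` V').
  by split=> //; exists (U', V').
by move=> z [/UU' zU /VV' zV]; apply: UVW.
Qed.

Section Manifold.
Variables (M : manifold R p) (N : manifold R q).

Definition pm_chart (c : charts M * charts N) :
    chart R (p + q) (M * N)%type :=
  prod_chart (chart_of c.1) (chart_of c.2).

Lemma pm_cover (z : M * N) : exists c, cdom (pm_chart c) z.
Proof.
have [c zc] := m_cover z.1; have [d zd] := m_cover z.2.
by exists (c, d).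
Qed.

Lemma pm_smooth (c d : charts M * charts N) (k : 'I_(p + q)) :
  smooth_on (cmap (pm_chart c) @` (cdom (pm_chart c) `&` cdom (pm_chart d)))
    (fun u => cmap (pm_chart d) (cinv (pm_chart c) u) 0 k).
Proof.
have [a ->|b ->] := split_ordP k.
  rewrite (_ : (fun _ => _) =
      (fun v => cmap (chart_of d.1) (cinv (chart_of c.1) v) 0 a) \o lsubmx).
    apply: (smooth_lsub (@m_smooth _ _ M c.1 d.1 a)) => _ [z [[z1 _] [z1' _]] <-].
    by rewrite /= /pc_map row_mxKl; exists z.1.
  by apply/funext => u; rewrite /= /pc_map row_mxEl.
rewrite (_ : (fun _ => _) =
    (fun v => cmap (chart_of d.2) (cinv (chart_of c.2) v) 0 b) \o rsubmx).
  apply: (smooth_rsub (@m_smooth _ _ N c.2 d.2 b)) => _ [z [[_ z2] [_ z2']] <-].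
  by rewrite /= /pc_map row_mxKr; exists z.2.
by apply/funext => u; rewrite /= /pc_map row_mxEr.
Qed.

Definition prod_manifold : manifold R (p + q) :=
  Manifold (prod_hausdorff (@m_hausdorff _ _ M) (@m_hausdorff _ _ N))
    (prod_second_countable (@m_second_countable _ _ M)
                           (@m_second_countable _ _ N))
    pm_cover pm_smooth.

Lemma pm_jacT (c d : charts prod_manifold) (u : 'rV[R]_(p + q)) :
  jacT (transition c d) u =
  block_mx (jacT (transition c.1 d.1) (lsubmx u)) 0
           0 (jacT (transition c.2 d.2) (rsubmx u)).
Proof.
have lE k : (fun v => transition c d v 0 (lshift q k)) =
    (fun v => transition c.1 d.1 v 0 k) \o lsubmx.
  by apply/funext => v; rewrite /transition /crd /= /pc_map row_mxEl.
have rE k : (fun v => transition c d v 0 (rshift p k)) =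
    (fun v => transition c.2 d.2 v 0 k) \o rsubmx.
  by apply/funext => v; rewrite /transition /crd /= /pc_map row_mxEr.
apply/matrixP => i j; rewrite mxE.
have [a ->|b ->] := split_ordP i; have [a' ->|b' ->] := split_ordP j.
- by rewrite block_mxEul lE pd_lsub mxE.
- by rewrite block_mxEur rE pd_rsub0 mxE.
- by rewrite block_mxEdl lE pd_lsub0 mxE.
- by rewrite block_mxEdr rE pd_rsub mxE.
Qed.

End Manifold.

Variables (M : semi_riemannian R p) (N : semi_riemannian R q).

Definition pmetric (c : charts (prod_manifold M N)) (u : 'rV[R]_(p + q)) :
    'M[R]_(p + q) :=
  block_mx (metric c.1 (lsubmx u)) 0 0 (metric c.2 (rsubmx u)).

Lemma pm_img (c : charts (prod_manifold M N)) u :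
  img c u -> img c.1 (lsubmx u) /\ img c.2 (rsubmx u).
Proof.
move=> [z [z1 z2] <-]; rewrite /crd /= /pc_map row_mxKl row_mxKr.
by split; [exists z.1|exists z.2].
Qed.

Lemma pmetric_smooth c i j : smooth_on (img c) (fun u => pmetric c u i j).
Proof.
have [a ->|b ->] := split_ordP i; have [a' ->|b' ->] := split_ordP j.
- rewrite (_ : (fun _ => _) = (fun v => metric c.1 v a a') \o lsubmx).
    by apply: (smooth_lsub (@g_smooth _ _ M c.1 a a')) => u /pm_img[].
  by apply/funext => u; rewrite /= block_mxEul.
- rewrite (_ : (fun _ => _) = cst 0); first exact: smooth_cst0.
  by apply/funext => u; rewrite /pmetric block_mxEur mxE.
- rewrite (_ : (fun _ => _) = cst 0); first exact: smooth_cst0.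
  by apply/funext => u; rewrite /pmetric block_mxEdl mxE.
- rewrite (_ : (fun _ => _) = (fun v => metric c.2 v b b') \o rsubmx).
    by apply: (smooth_rsub (@g_smooth _ _ N c.2 b b')) => u /pm_img[].
  by apply/funext => u; rewrite /= block_mxEdr.
Qed.

Lemma pmetric_sym c u : img c u -> (pmetric c u)^T = pmetric c u.
Proof.
by move=> /pm_img[u1 u2]; rewrite /pmetric tr_block_mx !trmx0 !g_sym.
Qed.

Lemma pmetric_nondeg c u : img c u -> pmetric c u \in unitmx.
Proof.
move=> /pm_img[u1 u2]; rewrite /pmetric unitmxE det_ublock unitrM.
by rewrite -!unitmxE !g_nondeg.
Qed.

Lemma pmetric_index : exists k, forall c u, img c u ->
  has_index k (pmetric c u).
Proof.
have [k1 H1] := g_index M; have [k2 H2] := g_index N.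
exists (k1 + k2)%N => c u /pm_img[/H1[P1 [d1 [uP1 E1 s1 n1]]]].
move=> /H2[P2 [d2 [uP2 E2 s2 n2]]].
exists (block_mx P1 0 0 P2), (row_mx d1 d2); split.
- by rewrite unitmxE det_ublock unitrM -!unitmxE uP1.
- rewrite /pmetric tr_block_mx !mulmx_block !trmx0.
  by rewrite !mulmx0 !mul0mx !addr0 !add0r E1 E2 !mul0mx diag_mx_row.
- move=> i; have [a ->|b ->] := split_ordP i; first by rewrite row_mxEl.
  by rewrite row_mxEr.
- rewrite -n1 -n2 -!sum1_card big_split_ord /=.
  by congr (_ + _)%N; apply: eq_bigl => i; rewrite !inE ?row_mxEl ?row_mxEr.
Qed.

Lemma pmetric_transf c d (x : prod_manifold M N) : dom c x -> dom d x ->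
  let J := jacT (transition c d) (crd c x) in
  pmetric c (crd c x) = J *m pmetric d (crd d x) *m J^T.
Proof.
move=> [c1 c2] [d1 d2] /=; rewrite pm_jacT /pmetric /crd /= /pc_map.
rewrite !row_mxKl !row_mxKr tr_block_mx !mulmx_block !trmx0.
rewrite !mulmx0 !mul0mx !addr0 !add0r !mul0mx.
by rewrite (g_transf c1 d1) (g_transf c2 d2).
Qed.

Definition prod_sr : semi_riemannian R (p + q) :=
  SemiRiemannian pmetric_smooth pmetric_sym pmetric_nondeg pmetric_index
    pmetric_transf.

End ProductManifold.

(* Pull-backs along the two projections, in product coordinates. *)
Section PullBack.
Context {R : realType} {p q : nat}.

Definition base1 (t : tens1 R p) : tens1 R (p + q) := fun i =>
  match fintype.split i with inl a => t a | inr _ => 0 end.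
Definition base2 (t : tens2 R p) : tens2 R (p + q) := fun i j =>
  base1 (fun a => base1 (t a) j) i.
Definition base4 (t : tens4 R p) : tens4 R (p + q) := fun i j k l =>
  base2 (fun a b => base2 (t a b) k l) i j.
Definition base5 (t : tens5 R p) : tens5 R (p + q) := fun i j k l m =>
  base1 (fun a => base4 (t a) j k l m) i.

Definition fibre1 (t : tens1 R q) : tens1 R (p + q) := fun i =>
  match fintype.split i with inl _ => 0 | inr b => t b end.
Definition fibre2 (t : tens2 R q) : tens2 R (p + q) := fun i j =>
  fibre1 (fun a => fibre1 (t a) j) i.
Definition fibre4 (t : tens4 R q) : tens4 R (p + q) := fun i j k l =>
  fibre2 (fun a b => fibre2 (t a b) k l) i j.
Definition fibre5 (t : tens5 R q) : tens5 R (p + q) := fun i j k l m =>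
  fibre1 (fun a => fibre4 (t a) j k l m) i.

End PullBack.

(* Tensors on the product M x N, by components in the product chart c at the
   point of coordinates u. *)
Section ProductTensors.
Context {R : realType} {p q : nat}.
Variables (M : semi_riemannian R p) (N : semi_riemannian R q).
Variables (c : charts (prod_sr M N)) (u : 'rV[R]_(p + q)).

Definition g_b : tens2 R (p + q) := base2 (gtens (M := M) c.1 (lsubmx u)).
Definition S_b : tens2 R (p + q) := base2 (ricci (M := M) c.1 (lsubmx u)).
Definition R_b : tens4 R (p + q) := base4 (riemann (M := M) c.1 (lsubmx u)).
Definition nablaR_b : tens5 R (p + q) :=
  base5 (nabla_riemann (M := M) c.1 (lsubmx u)).

Definition g_f : tens2 R (p + q) := fibre2 (gtens (M := N) c.2 (rsubmx u)).
Definition S_f : tens2 R (p + q) := fibre2 (ricci (M := N) c.2 (rsubmx u)).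
Definition R_f : tens4 R (p + q) := fibre4 (riemann (M := N) c.2 (rsubmx u)).
Definition nablaR_f : tens5 R (p + q) :=
  fibre5 (nabla_riemann (M := N) c.2 (rsubmx u)).

(* Parts of a 1-form of the product along the base and along the fibre; their
   coefficients still depend on all p + q coordinates. *)
Definition part_b (w : one_form (prod_sr M N)) : tens1 R (p + q) :=
  base1 (fun a => w c u 0 (lshift q a)).
Definition part_f (w : one_form (prod_sr M N)) : tens1 R (p + q) :=
  fibre1 (fun b => w c u 0 (rshift p b)).

End ProductTensors.

(* Main.v *)
(* In product charts the metric is block diagonal, and so are its inverse, the
   Christoffel symbols, R, S and nabla R: each is the sum of its base and fibre
   counterparts. Since g /\ S = gb /\ Sb + gf /\ Sf + gb /\ Sf + gf /\ Sb, the
   pure base, pure fibre and mixed components of the recurrence equation give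
   conditions 1, 2 and 3, and conversely the six conditions add up to it. The
   equivalence thus holds pointwise. *)
Require Import Defs.
From mathcomp Require Import all_boot all_order all_algebra.
From mathcomp Require Import all_classical all_reals all_analysis.
From mathcomp Require Import lra.

Set Implicit Arguments.
Unset Strict Implicit.
Unset Printing Implicit Defensive.

Import Order.TTheory GRing.Theory Num.Theory.
Import numFieldNormedType.Exports.
Local Open Scope classical_set_scope.
Local Open Scope ring_scope.

(** * Block sums of pulled-back arrays and their partial derivatives *)

Section PullBackTheory.
Context {R : realType} {p q : nat}.

Lemma base1_lshift (t : tens1 R p) a : base1 t (lshift q a) = t a.
Proof. by rewrite /base1 (unsplitK (inl a)). Qed.

Lemma base1_rshift (t : tens1 R p) b : base1 t (rshift p b : 'I_(p + q)) = 0.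
Proof. by rewrite /base1 (unsplitK (inr b)). Qed.

Lemma fibre1_lshift (t : tens1 R q) a : fibre1 t (lshift q a : 'I_(p + q)) = 0.
Proof. by rewrite /fibre1 (unsplitK (inl a)). Qed.

Lemma fibre1_rshift (t : tens1 R q) b : fibre1 t (rshift p b) = t b.
Proof. by rewrite /fibre1 (unsplitK (inr b)). Qed.

Definition pullE :=
  (base1_lshift, base1_rshift, fibre1_lshift, fibre1_rshift).

(** Three-index arrays are needed for Christoffel symbols and for first derivatives of the
    metric. *)
Definition base3 (t : 'I_p -> tens2 R p) (i : 'I_(p + q)) : tens2 R (p + q) :=
  fun j k => base1 (fun a => base2 (t a) j k) i.

Definition fibre3 (t : 'I_q -> tens2 R q) (i : 'I_(p + q)) : tens2 R (p + q) :=
  fun j k => fibre1 (fun a => fibre2 (t a) j k) i.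

(** Block sums: a component with all indices in one factor comes from that factor, and a component
    with mixed indices is zero. *)
Definition dsum2 (s : tens2 R p) (t : tens2 R q) : tens2 R (p + q) :=
  fun i j => base2 s i j + fibre2 t i j.
Definition dsum3 (s : 'I_p -> tens2 R p) (t : 'I_q -> tens2 R q) :
    'I_(p + q) -> tens2 R (p + q) :=
  fun i j k => base3 s i j k + fibre3 t i j k.
Definition dsum4 (s : tens4 R p) (t : tens4 R q) : tens4 R (p + q) :=
  fun i j k l => base4 s i j k l + fibre4 t i j k l.
Definition dsum5 (s : tens5 R p) (t : tens5 R q) : tens5 R (p + q) :=
  fun i j k l m => base5 s i j k l m + fibre5 t i j k l m.

(** A partial derivative depends only on the germ of the function, so identities valid on an open
    set can be differentiated there. *)
Lemma pd_near n (D : set 'rV[R]_n) (f h : 'rV[R]_n -> R) i u :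
  open D -> D u -> {in D, f =1 h} -> pd i f u = pd i h u.
Proof.
move=> oD Du fh; apply: near_eq_derive; near=> v; apply: fh.
rewrite inE; near: v; exact: open_nbhs_nbhs.
Unshelve. all: by end_near. Qed.

Lemma pd_cst0 n (i : 'I_n) (u : 'rV[R]_n) : pd i (fun _ => 0 : R) u = 0.
Proof. exact: derive_cst. Qed.

(** For a fixed index the zero extension is either a component of [T] or the zero function, so it
    commutes with [pd] without any differentiability. *)
Lemma pd_base1 n (T : 'rV[R]_n -> tens1 R p) m (i : 'I_(p + q)) u :
  pd m (fun v => base1 (T v) i) u = base1 (fun a => pd m (fun v => T v a) u) i.
Proof.
have [a ->|b ->] := split_ordP i; rewrite pullE.
  by congr pd; apply/funext => v; rewrite pullE.
rewrite (_ : (fun v => _) = fun=> 0) ?pd_cst0 //.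
by apply/funext => v; exact: base1_rshift.
Qed.

Lemma pd_fibre1 n (T : 'rV[R]_n -> tens1 R q) m (i : 'I_(p + q)) u :
  pd m (fun v => fibre1 (T v) i) u =
  fibre1 (fun a => pd m (fun v => T v a) u) i.
Proof.
have [a ->|b ->] := split_ordP i; rewrite pullE.
  rewrite (_ : (fun v => _) = fun=> 0) ?pd_cst0 //.
  by apply/funext => v; exact: fibre1_lshift.
by congr pd; apply/funext => v; rewrite pullE.
Qed.

(* The disjunction replaces a differentiability hypothesis. *)
Lemma pd_split (D : set 'rV[R]_(p + q)) h f g m u :
  open D -> D u -> f = cst 0 \/ g = cst 0 ->
  (forall v, D v -> h v = f (lsubmx v) + g (rsubmx v)) ->
  pd m h u = base1 (fun a => pd a f (lsubmx u)) m
             + fibre1 (fun b => pd b g (rsubmx u)) m.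
Proof.
move=> oD Du fg hE.
have cst0 n (i : 'I_n) (w : 'rV[R]_n) : pd i (cst 0 : _ -> R) w = 0.
  exact: pd_cst0.
case: fg => fg; move: hE; rewrite {}fg => hE.
  (* On [D] the function is now a pull-back from a single factor, and its derivatives along the
     other factor vanish. *)
  rewrite (@pd_near _ D h (g \o rsubmx)) //; last first.
    by move=> v /[!inE] Dv; rewrite hE //= add0r.
  have [a ->|b ->] := split_ordP m; rewrite !pullE.
    by rewrite pd_rsub0 cst0 addr0.
  by rewrite pd_rsub add0r.
rewrite (@pd_near _ D h (f \o lsubmx)) //; last first.
  by move=> v /[!inE] Dv; rewrite hE //= addr0.
have [a ->|b ->] := split_ordP m; rewrite !pullE.
  by rewrite pd_lsub addr0.
by rewrite pd_lsub0 cst0 add0r.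
Qed.

(** The index [i] lies in one block, so the summand of the other block is identically zero; this
    provides the disjunction of [pd_split]. *)
Lemma pd_split1 (D : set 'rV[R]_(p + q)) h (T : 'rV[R]_p -> tens1 R p)
    (T' : 'rV[R]_q -> tens1 R q) m u i :
  open D -> D u ->
  (forall v, D v ->
     h v = base1 (T (lsubmx v)) i + fibre1 (T' (rsubmx v)) i) ->
  pd m h u =
    base1 (fun a => base1 (fun x => pd a (T^~ x) (lsubmx u)) i) m
    + fibre1 (fun b => fibre1 (fun x => pd b (T'^~ x) (rsubmx u)) i) m.
Proof.
move=> oD Du hE.
rewrite (@pd_split D h (fun v => base1 (T v) i) (fun v => fibre1 (T' v) i)) //.
  congr (_ + _); [congr base1|congr fibre1]; apply/funext => a.
    exact: pd_base1.
  exact: pd_fibre1.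
have [a ->|b ->] := split_ordP i; [right|left]; apply/funext => v.
  exact: fibre1_lshift.
exact: base1_rshift.
Qed.

(** Freezing every index but the first reduces this and the next two lemmas to [pd_split1]. The
    direction [m] becomes the first index of the result. *)
Lemma pd_split2 (D : set 'rV[R]_(p + q)) h (T : 'rV[R]_p -> tens2 R p)
    (T' : 'rV[R]_q -> tens2 R q) m u i j :
  open D -> D u ->
  (forall v, D v ->
     h v = dsum2 (T (lsubmx v)) (T' (rsubmx v)) i j) ->
  pd m h u =
    dsum3 (fun a x y => pd a (fun v => T v x y) (lsubmx u))
          (fun a x y => pd a (fun v => T' v x y) (rsubmx u)) m i j.
Proof.
move=> oD Du hE.
rewrite (@pd_split1 D h (fun v a => base1 (T v a) j)
  (fun v a => fibre1 (T' v a) j) m u i oD Du hE).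
rewrite /dsum3; congr (_ + _); [congr base1|congr fibre1]; apply/funext => a;
  [congr base1|congr fibre1]; apply/funext => x.
  exact: pd_base1.
exact: pd_fibre1.
Qed.

Lemma pd_split3 (D : set 'rV[R]_(p + q)) h
    (T : 'rV[R]_p -> 'I_p -> tens2 R p) (T' : 'rV[R]_q -> 'I_q -> tens2 R q)
    m u i j k :
  open D -> D u ->
  (forall v, D v ->
     h v = dsum3 (T (lsubmx v)) (T' (rsubmx v)) i j k) ->
  pd m h u =
    dsum4 (fun a x y z => pd a (fun v => T v x y z) (lsubmx u))
          (fun a x y z => pd a (fun v => T' v x y z) (rsubmx u)) m i j k.
Proof.
move=> oD Du hE.
rewrite (@pd_split1 D h (fun v a => base2 (T v a) j k)
  (fun v a => fibre2 (T' v a) j k) m u i oD Du hE).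
rewrite /dsum4; congr (_ + _); [congr base1|congr fibre1]; apply/funext => a;
  [congr base1|congr fibre1]; apply/funext => x.
  by rewrite pd_base1; congr base1; apply/funext => y; exact: pd_base1.
by rewrite pd_fibre1; congr fibre1; apply/funext => y; exact: pd_fibre1.
Qed.

Lemma pd_split4 (D : set 'rV[R]_(p + q)) h
    (T : 'rV[R]_p -> tens4 R p) (T' : 'rV[R]_q -> tens4 R q)
    m u i j k l :
  open D -> D u ->
  (forall v, D v ->
     h v = dsum4 (T (lsubmx v)) (T' (rsubmx v)) i j k l) ->
  pd m h u =
    dsum5 (fun a x y z w => pd a (fun v => T v x y z w) (lsubmx u))
          (fun a x y z w => pd a (fun v => T' v x y z w) (rsubmx u)) m i j k l.
Proof.
move=> oD Du hE.
rewrite (@pd_split1 D h (fun v a => base1 (fun b => base2 (T v a b) k l) j)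
  (fun v a => fibre1 (fun b => fibre2 (T' v a b) k l) j) m u i oD Du hE).
rewrite /dsum5; congr (_ + _); [congr base1|congr fibre1]; apply/funext => a;
  [congr base1|congr fibre1]; apply/funext => x.
  rewrite pd_base1; congr base1; apply/funext => y.
  by rewrite pd_base1; congr base1; apply/funext => z; exact: pd_base1.
rewrite pd_fibre1; congr fibre1; apply/funext => y.
by rewrite pd_fibre1; congr fibre1; apply/funext => z; exact: pd_fibre1.
Qed.

End PullBackTheory.

(** * Curvature formulas as algebraic operations, compatible with block sums *)

Section Contractions.
Context {R : realType}.

(** Here [h] is the inverse metric and [d b i j] the derivative of g_ij in direction [b]. Treating
    derivatives as independent arrays makes the splittings pure algebra. *)
Definition christoffel_of n (h : tens2 R n) (d : 'I_n -> tens2 R n) :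
    'I_n -> tens2 R n := fun a i j =>
  2^-1 * \sum_(b < n) h a b * (d i j b + d j i b - d b i j).

(* Components R^a_{ijk}, with the sign convention of [riemann]. *)
Definition riemann_up_of n (d : tens4 R n) (G : 'I_n -> tens2 R n) :
    tens4 R n := fun a i j k =>
  d j a i k + \sum_(b < n) G b i k * G a j b
  - (d i a j k + \sum_(b < n) G b j k * G a i b).

Definition lower n (T : tens4 R n) (g : tens2 R n) : tens4 R n :=
  fun i j k l => \sum_(a < n) T a i j k * g a l.

Definition ricci_of n (h : tens2 R n) (T : tens4 R n) : tens2 R n :=
  fun j k => \sum_(i < n) \sum_(l < n) h i l * T i j k l.

(** The direction of differentiation is the first index of [d], as in [pd_split4], but the last
    index of the result, as in R_{ijkl,m}. *)
Definition covariant_derivative n (d : tens5 R n) (G : 'I_n -> tens2 R n)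
    (T : tens4 R n) : tens5 R n := fun i j k l m =>
  d m i j k l
  - \sum_(a < n) G a m i * T a j k l - \sum_(a < n) G a m j * T i a k l
  - \sum_(a < n) G a m k * T i j a l - \sum_(a < n) G a m l * T i j k a.

Context {p q : nat}.
Implicit Types i j k l m : 'I_(p + q).

Let simp := (addr0, add0r, subr0, sub0r, mulr0, mul0r, oppr0).

Lemma christoffel_of_dsum hb hf db df a i j :
  christoffel_of (dsum2 hb hf) (dsum3 db df) a i j =
  dsum3 (christoffel_of hb db) (christoffel_of hf df) a i j :> R.
Proof.
rewrite /christoffel_of big_split_ord /= /dsum3 /dsum2 /base3 /fibre3 /base2
  /fibre2.
have [a' ->|a' ->] := @split_ordP p q a; have [i' ->|i' ->] := split_ordP i;
  have [j' ->|j' ->] := split_ordP j; rewrite !pullE !simp;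
  under eq_bigr do rewrite !pullE !simp;
  under [X in _ + X]eq_bigr do rewrite !pullE !simp;
  by rewrite ?big1_eq !simp.
Qed.

(** Since [f] is arbitrary, this serves both the quadratic terms of the curvature and the connection
    terms of the covariant derivative. Only the block containing both [i] and [j] contributes. *)
Lemma sum_dsum3 Gb Gf (f : 'I_(p + q) -> R) i j :
  \sum_(a < p + q) dsum3 Gb Gf a i j * f a =
    dsum2 (fun x y => \sum_(a < p) Gb a x y * f (lshift q a))
          (fun x y => \sum_(a < q) Gf a x y * f (rshift p a)) i j.
Proof.
rewrite big_split_ord /= /dsum3 /dsum2 /base3 /fibre3 /base2 /fibre2.
have [i' ->|i' ->] := split_ordP i; have [j' ->|j' ->] := split_ordP j;
  rewrite !pullE !simp;
  under eq_bigr do rewrite !pullE !simp;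
  under [X in _ + X]eq_bigr do rewrite !pullE !simp;
  by rewrite ?big1_eq ?simp.
Qed.

Lemma riemann_up_of_dsum db df Gb Gf a i j k :
  riemann_up_of (dsum4 db df) (dsum3 Gb Gf) a i j k =
  dsum4 (riemann_up_of db Gb) (riemann_up_of df Gf) a i j k.
Proof.
rewrite /riemann_up_of !sum_dsum3 /dsum4 /dsum3 /dsum2.
rewrite /base4 /fibre4 /base3 /fibre3 /base2 /fibre2.
have [a' ->|a' ->] := @split_ordP p q a; have [i' ->|i' ->] := split_ordP i;
  have [j' ->|j' ->] := split_ordP j; have [k' ->|k' ->] := split_ordP k;
  rewrite !pullE ?simp.
(* With mixed indices every term vanishes; the two pure blocks remain and match term by term. *)
all: try by rewrite ?big1 ?simp // => *; rewrite !pullE ?simp.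
all: by congr (_ + _ - (_ + _)); apply: eq_bigr => x _; rewrite !pullE ?simp.
Qed.

Lemma lower_dsum Tb Tf gb gf i j k l :
  lower (dsum4 Tb Tf) (dsum2 gb gf) i j k l =
  dsum4 (lower Tb gb) (lower Tf gf) i j k l :> R.
Proof.
rewrite /lower big_split_ord /= /dsum4 /dsum2 /base4 /fibre4 /base2 /fibre2.
have [i' ->|i' ->] := @split_ordP p q i; have [j' ->|j' ->] := split_ordP j;
  have [k' ->|k' ->] := split_ordP k; have [l' ->|l' ->] := split_ordP l;
  rewrite !pullE ?simp;
  under eq_bigr do rewrite !pullE ?simp;
  under [X in _ + X]eq_bigr do rewrite !pullE ?simp;
  by rewrite ?big1_eq ?simp.
Qed.

Lemma ricci_of_dsum hb hf Tb Tf j k :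
  ricci_of (dsum2 hb hf) (dsum4 Tb Tf) j k =
  dsum2 (ricci_of hb Tb) (ricci_of hf Tf) j k :> R.
Proof.
rewrite /ricci_of big_split_ord /=.
(* Inner sum for [i] in the base: the inverse metric confines [l] to the base, and the curvature
   array then confines [j] and [k]. *)
have Eb (i : 'I_p) : \sum_(l < p + q)
    dsum2 hb hf (lshift q i) l * dsum4 Tb Tf (lshift q i) j k l =
  base2 (fun x y => \sum_(l < p) hb i l * Tb i x y l) j k.
  rewrite big_split_ord /= /dsum2 /dsum4 /base4 /base2 /fibre4 /fibre2.
  have [j' ->|j' ->] := split_ordP j; have [k' ->|k' ->] := split_ordP k;
    rewrite !pullE ?simp;
    under eq_bigr do rewrite !pullE ?simp;
    under [X in _ + X]eq_bigr do rewrite !pullE ?simp;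
    by rewrite ?big1_eq ?simp.
have Ef (i : 'I_q) : \sum_(l < p + q)
    dsum2 hb hf (rshift p i) l * dsum4 Tb Tf (rshift p i) j k l =
  fibre2 (fun x y => \sum_(l < q) hf i l * Tf i x y l) j k.
  rewrite big_split_ord /= /dsum2 /dsum4 /base4 /base2 /fibre4 /fibre2.
  have [j' ->|j' ->] := split_ordP j; have [k' ->|k' ->] := split_ordP k;
    rewrite !pullE ?simp;
    under eq_bigr do rewrite !pullE ?simp;
    under [X in _ + X]eq_bigr do rewrite !pullE ?simp;
    by rewrite ?big1_eq ?simp.
under eq_bigr do rewrite Eb /base2.
under [X in _ + X]eq_bigr do rewrite Ef /fibre2.
rewrite /dsum2 /base2 /fibre2.
have [j' ->|j' ->] := split_ordP j; have [k' ->|k' ->] := split_ordP k;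
  rewrite !pullE ?simp;
  under eq_bigr do rewrite !pullE;
  under [X in _ + X]eq_bigr do rewrite !pullE;
  by rewrite ?big1_eq ?simp.
Qed.

Lemma covariant_derivative_dsum db df Gb Gf Tb Tf i j k l m :
  covariant_derivative (dsum5 db df) (dsum3 Gb Gf) (dsum4 Tb Tf) i j k l m =
  dsum5 (covariant_derivative db Gb Tb) (covariant_derivative df Gf Tf)
    i j k l m.
Proof.
rewrite /covariant_derivative !sum_dsum3 /dsum5 /dsum4 /dsum2.
rewrite /base5 /fibre5 /base4 /fibre4 /base2 /fibre2.
have [m' ->|m' ->] := @split_ordP p q m; have [i' ->|i' ->] := split_ordP i;
  have [j' ->|j' ->] := split_ordP j; have [k' ->|k' ->] := split_ordP k;
  have [l' ->|l' ->] := split_ordP l; rewrite ?pullE ?simp.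
(* Of the 32 placements of the five indices, all but the two pure ones make every term zero. *)
all: try by rewrite ?big1 ?simp // => *; rewrite ?pullE ?simp.
all: by congr (_ - _ - _ - _ - _); apply: eq_bigr => x _; rewrite ?pullE ?simp.
Qed.

End Contractions.

(** * Classical coordinate formulas in a single chart *)

Section CoordinateFormulas.
Context {R : realType} {n : nat} (M : semi_riemannian R n) (c : charts M).
Implicit Types (u : 'rV[R]_n) (i j k l : 'I_n).

Definition inverse_metric u : tens2 R n := fun i j => invmx (metric c u) i j.

Definition riemann_up u : tens4 R n :=
  riemann_up_of (fun m a i j => pd m (christoffel c a i j) u)
                (fun a i j => christoffel c a i j u).

(** Coordinate fields have constant components, so only the connection term survives. *)
Lemma nabla_coord_field i k u a :
  nabla c i (coord_field k) u 0 a = christoffel c a i k u.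
Proof.
rewrite mxE /coord_field [pd _ _ _]derive_cst add0r (bigD1 k) //= big1.
  by rewrite mxE !eqxx mulr1 addr0.
by move=> b /negPf bk; rewrite mxE bk andbF mulr0.
Qed.

Lemma nabla2_coord_field i j k u a :
  nabla c j (nabla c i (coord_field k)) u 0 a =
    pd j (christoffel c a i k) u
    + \sum_(b < n) christoffel c b i k u * christoffel c a j b u.
Proof.
rewrite mxE; congr (_ + _).
  by congr pd; apply/funext => v; exact: nabla_coord_field.
by apply: eq_bigr => b _; rewrite nabla_coord_field mulrC.
Qed.

(** This turns the commutator of covariant derivatives into the Christoffel formula with its upper
    index lowered, the form to which [riemann_up_of_dsum] and [lower_dsum] apply. *)
Lemma riemann_lower u : riemann c u = lower (riemann_up u) (gtens c u).
Proof.
have subE (V W : 'rV[R]_n) a : (V - W) 0 a = V 0 a - W 0 a by rewrite !mxE.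
apply/funext => i; apply/funext => j; apply/funext => k; apply/funext => l.
rewrite /riemann trmx_delta -colE 2!mxE; apply: eq_bigr => a _.
by rewrite subE !nabla2_coord_field.
Qed.

(** This identity and the next two hold by conversion; they expose the arrays to be split. *)
Lemma christoffelE u : (fun a i j => christoffel c a i j u) =
  christoffel_of (inverse_metric u)
    (fun m i j => pd m (fun v => metric c v i j) u).
Proof. by []. Qed.

Lemma ricciE u : ricci c u = ricci_of (inverse_metric u) (riemann c u).
Proof. by []. Qed.

Lemma nabla_riemannE u : nabla_riemann c u =
  covariant_derivative (fun m i j k l => pd m (fun v => riemann c v i j k l) u)
    (fun a i j => christoffel c a i j u) (riemann c u).
Proof. by []. Qed.

End CoordinateFormulas.

(** * Splitting of the product curvature on the image of a product chart *)

Section ProductCurvature.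
Context {R : realType} {p q : nat}.
Variables (B : semi_riemannian R p) (F : semi_riemannian R q).
Variable c : charts (prod_sr B F).
Implicit Types (u : 'rV[R]_(p + q)) (i j k l m : 'I_(p + q)).

Let bc : charts B := c.1.
Let fc : charts F := c.2.

Let img_open : open (img c).
Proof. exact: cimg_open. Qed.

Let block_dsum2 (A : 'M[R]_p) (D : 'M[R]_q) :
  (fun i j => block_mx A 0 0 D i j) =
  dsum2 (fun a b => A a b) (fun a b => D a b).
Proof.
apply/funext => i; apply/funext => j; rewrite /dsum2 /base2 /fibre2.
have [a ->|b ->] := split_ordP i; have [a' ->|b' ->] := split_ordP j;
  rewrite !pullE ?(block_mxEul, block_mxEur, block_mxEdl, block_mxEdr).
- by rewrite addr0.
- by rewrite addr0 mxE.
- by rewrite addr0 mxE.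
- by rewrite add0r.
Qed.

Lemma gtens_split u : gtens c u =
  dsum2 (gtens bc (lsubmx u)) (gtens fc (rsubmx u)).
Proof. exact: block_dsum2. Qed.

(* Off [img c] one block may be singular, where [invmx] is the identity: the
   splittings hold on [img c] only, and derivatives have to be taken locally. *)
Lemma inverse_metric_split u : img c u -> inverse_metric c u =
  dsum2 (inverse_metric bc (lsubmx u)) (inverse_metric fc (rsubmx u)).
Proof.
move=> cu; rewrite -block_dsum2 -invmx_block_diag //.
exact: (pmetric_nondeg cu).
Qed.

Lemma pd_metric_split u : img c u ->
  (fun m i j => pd m (fun v => metric c v i j) u) =
  dsum3 (fun a x y => pd a (fun v => metric bc v x y) (lsubmx u))
        (fun a x y => pd a (fun v => metric fc v x y) (rsubmx u)).
Proof.
move=> cu; apply/funext => m; apply/funext => i; apply/funext => j.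
apply: (pd_split2 (T := gtens bc) (T' := gtens fc) m img_open cu) => v _.
by rewrite -gtens_split.
Qed.

Lemma christoffel_split u : img c u -> (fun a i j => christoffel c a i j u) =
  dsum3 (fun a x y => christoffel bc a x y (lsubmx u))
        (fun a x y => christoffel fc a x y (rsubmx u)).
Proof.
move=> cu; rewrite !christoffelE inverse_metric_split // pd_metric_split //.
do 3![apply/funext => ?]; exact: christoffel_of_dsum.
Qed.

(** The splitting of the Christoffel symbols is known on [img c] only; as this set is open, it may
    be differentiated there. *)
Lemma pd_christoffel_split u : img c u ->
  (fun m a i j => pd m (christoffel c a i j) u) =
  dsum4 (fun a x y z => pd a (christoffel bc x y z) (lsubmx u))
        (fun a x y z => pd a (christoffel fc x y z) (rsubmx u)).
Proof.
move=> cu; apply/funext => m; apply/funext => a; apply/funext => i.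
apply/funext => j.
apply: (pd_split3 (T := fun v x y z => christoffel bc x y z v)
  (T' := fun v x y z => christoffel fc x y z v) m img_open cu) => v cv.
by rewrite -christoffel_split.
Qed.

Lemma riemann_up_split u : img c u -> riemann_up c u =
  dsum4 (riemann_up bc (lsubmx u)) (riemann_up fc (rsubmx u)).
Proof.
move=> cu; rewrite /riemann_up christoffel_split // pd_christoffel_split //.
do 4![apply/funext => ?]; exact: riemann_up_of_dsum.
Qed.

Lemma riemann_split u : img c u -> riemann c u =
  dsum4 (riemann bc (lsubmx u)) (riemann fc (rsubmx u)).
Proof.
move=> cu; rewrite !riemann_lower riemann_up_split // gtens_split.
do 4![apply/funext => ?]; exact: lower_dsum.
Qed.

Lemma ricci_split u : img c u ->
  ricci c u = dsum2 (ricci bc (lsubmx u)) (ricci fc (rsubmx u)).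
Proof.
move=> cu; rewrite !ricciE inverse_metric_split // riemann_split //.
do 2![apply/funext => ?]; exact: ricci_of_dsum.
Qed.

Lemma nabla_riemann_split u : img c u -> nabla_riemann c u =
  dsum5 (nabla_riemann bc (lsubmx u)) (nabla_riemann fc (rsubmx u)).
Proof.
move=> cu; rewrite !nabla_riemannE christoffel_split // riemann_split //.
have -> : (fun m i j k l => pd m (fun v => riemann c v i j k l) u) =
  dsum5 (fun a x y z w => pd a (fun v => riemann bc v x y z w) (lsubmx u))
        (fun a x y z w => pd a (fun v => riemann fc v x y z w) (rsubmx u)).
  do 5![apply/funext => ?].
  apply: (pd_split4 (T := riemann bc) (T' := riemann fc) _ img_open cu) => v cv.
  by rewrite riemann_split.
do 5![apply/funext => ?]; exact: covariant_derivative_dsum.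
Qed.

Lemma one_form_split (w : one_form (prod_sr B F)) u m :
  w c u 0 m = part_b c u w m + part_f c u w m.
Proof.
rewrite /part_b /part_f.
have [a ->|b ->] := split_ordP m; rewrite !pullE.
  by rewrite addr0.
by rewrite add0r.
Qed.

End ProductCurvature.

(** * Base, fibre and mixed components of the recurrence equation *)

Section Decomposition.
Context {R : realType} {p q : nat}.
Variables (P Q : tens1 R p) (P' Q' : tens1 R q).
Variables (gb Sb : tens2 R p) (gf Sf : tens2 R q).
Variables (Rb : tens4 R p) (Rf : tens4 R q).
Variables (Db : tens5 R p) (Df : tens5 R q).
Implicit Types i j k l m : 'I_(p + q).

Let simp := (addr0, add0r, subr0, sub0r, mulr0, mul0r, oppr0).

(** This is algebra at one point: the ten arrays and covectors stand for the values of the tensors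
    and 1-forms there. *)
Lemma recurrence_dsum :
  (forall i j k l m, dsum5 Db Df i j k l m =
     (base1 P m + fibre1 P' m) * dsum4 Rb Rf i j k l
     + (base1 Q m + fibre1 Q' m)
       * kulkarni_nomizu (dsum2 gb gf) (dsum2 Sb Sf) i j k l) <->
  ((forall i j k l m, base5 Db i j k l m =
      base1 P m * base4 Rb i j k l
      + base1 Q m * kulkarni_nomizu (base2 gb) (base2 Sb) i j k l) /\
   (forall i j k l m, fibre1 P' m * base4 Rb i j k l
      + fibre1 Q' m * kulkarni_nomizu (base2 gb) (base2 Sb) i j k l = 0)) /\
  ((forall i j k l m, base1 P m * fibre4 Rf i j k l
      + base1 Q m * kulkarni_nomizu (fibre2 gf) (fibre2 Sf) i j k l = 0) /\
   (forall i j k l m, fibre5 Df i j k l m =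
      fibre1 P' m * fibre4 Rf i j k l
      + fibre1 Q' m * kulkarni_nomizu (fibre2 gf) (fibre2 Sf) i j k l)) /\
  ((forall i j k l m, base1 Q m * base2 gb i j * fibre2 Sf k l =
      - (base1 Q m * base2 Sb i j * fibre2 gf k l)) /\
   (forall i j k l m, fibre1 Q' m * base2 gb i j * fibre2 Sf k l =
      - (fibre1 Q' m * base2 Sb i j * fibre2 gf k l))).
Proof.
split=> [H|[[H1 H2] [[H3 H4] [H5 H6]]] i j k l m]; last first.
  rewrite /dsum5 H1 H4 /dsum4 !mulrDl !mulrDr.
  move: (H2 i j k l m) (H3 i j k l m).
  (* Each of the four products in g /\ S contributes two mixed terms. The condition on mixed terms
     at the matching index placement cancels such a pair, once for each part of Psi. *)
  move: (H5 i l j k m) (H5 j k i l m) (H5 i k j l m) (H5 j l i k m).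
  move: (H6 i l j k m) (H6 j k i l m) (H6 i k j l m) (H6 j l i k m).
  rewrite /kulkarni_nomizu /dsum2.
  set x := base1 Q m; set y := fibre1 Q' m.
  move: (base2 gb) (base2 Sb) (fibre2 gf) (fibre2 Sf) => a b a' b'.
  (* Once the factors are abstracted, the goal is a linear combination of the hypotheses, with
     products as monomials. *)
  move: (base4 _ _ _ _ _) (fibre4 _ _ _ _ _) => r r'.
  move: (base1 P m) (fibre1 P' m) => z z'.
  by lra.
split; [split|split; split] => i j k l m.
(* When [i], [j], [k], [l] lie in the block of the condition and [m] in the block of its 1-forms,
   [H] is that condition; otherwise both of its sides are zero. *)
1,2,3,4: move: (H i j k l m);
  rewrite /kulkarni_nomizu /dsum5 /dsum4 /dsum2 /base5 /fibre5 /base4 /fibre4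
    /base2 /fibre2;
  have [m' ->|m' ->] := @split_ordP p q m; have [i' ->|i' ->] := split_ordP i;
  have [j' ->|j' ->] := split_ordP j; have [k' ->|k' ->] := split_ordP k;
  have [l' ->|l' ->] := split_ordP l; by rewrite ?pullE ?simp.
(* The mixed components, read in the order in which g_{ij} S_{kl} occurs. *)
all: move: (H i k l j m);
  rewrite /kulkarni_nomizu /dsum5 /dsum4 /dsum2 /base5 /fibre5 /base4 /fibre4
    /base2 /fibre2;
  have [m' ->|m' ->] := @split_ordP p q m; have [i' ->|i' ->] := split_ordP i;
  have [j' ->|j' ->] := split_ordP j; have [k' ->|k' ->] := split_ordP k;
  have [l' ->|l' ->] := split_ordP l; rewrite ?pullE ?simp //; lra.
Qed.

End Decomposition.

Theorem corollary4p9 (R : realType) (p q : nat)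
  (p_gt0 : (0 < p)%N) (q_gt0 : (0 < q)%N) (n_ge3 : (3 <= p + q)%N)
  (B : semi_riemannian R p) (F : semi_riemannian R q)
  (nonflat : ~ flat (prod_sr B F))
  (Pi Psi : one_form (prod_sr B F)) :
  HGK Pi Psi <->
  (forall x : prod_sr B F, nonrecurrent_set x ->
   forall c : charts (prod_sr B F), dom c x -> let u := crd c x in
   ((forall i j k l m,
       nablaR_b c u i j k l m =
         part_b c u Pi m * R_b c u i j k l
         + part_b c u Psi m * kulkarni_nomizu (g_b c u) (S_b c u) i j k l) /\
    (forall i j k l m,
       part_f c u Pi m * R_b c u i j k l
         + part_f c u Psi m * kulkarni_nomizu (g_b c u) (S_b c u) i j k l = 0)) /\
   ((forall i j k l m,
       part_b c u Pi m * R_f c u i j k l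
         + part_b c u Psi m * kulkarni_nomizu (g_f c u) (S_f c u) i j k l = 0) /\
    (forall i j k l m,
       nablaR_f c u i j k l m =
         part_f c u Pi m * R_f c u i j k l
         + part_f c u Psi m * kulkarni_nomizu (g_f c u) (S_f c u) i j k l)) /\
   ((forall i j k l m,
       part_b c u Psi m * g_b c u i j * S_f c u k l =
         - (part_b c u Psi m * S_b c u i j * g_f c u k l)) /\
    (forall i j k l m,
       part_f c u Psi m * g_b c u i j * S_f c u k l =
         - (part_f c u Psi m * S_b c u i j * g_f c u k l)))).
Proof.
split=> H x xU c cx; have cu : img c (crd c x) by exists x.
  apply/recurrence_dsum => i j k l m.
  rewrite -!one_form_split -gtens_split -ricci_split // -riemann_split //.
  by rewrite -nabla_riemann_split //; exact: H.
move=> u i j k l m; rewrite /u nabla_riemann_split // riemann_split //.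
rewrite gtens_split ricci_split // !one_form_split.
by move: i j k l m; apply/recurrence_dsum; exact: H.
Qed.
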